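(* Let $\mathcal{M}\subset\mathbb{N}^n$ be a finite non-empty set. There exist constants $B$ and $C$ depending only on the coefficients $a(\alpha)$ with $\alpha\in\mathcal{M}_2$ (i.e., $B=B\big((a(\alpha))_{\alpha\in\mathcal{M}_2}\big)$ and $C=C\big((a(\alpha))_{\alpha\in\mathcal{M}_2}\big)$ for functions $B,C$ depending only on $n$ and $\mathcal{M}$) such that for every stable polynomial $f(z)=\sum_\alpha a(\alpha)z^\alpha\in\mathbb{C}[z_1,\ldots,z_n]$ with $\mathcal{M}(f)=\mathcal{M}$, $$\max\{|f(z)|:|z_i|\le r,\ 1\le i\le n\}\le Be^{Cr^2}\quad\text{for all } r\ge0.$$ Moreover, $B$ and $C$ can be chosen to depend continuously on the aforementioned set of coefficients.
   Context: $H=\{z\in\mathbb{C}:\Im(z)>0\}$; a polynomial is stable if it is non-zero whenever all variables lie in $H$. For $f=\sum a(\alpha)z^\alpha$, $\mathrm{supp}(f)=\{\alpha\in\mathbb{N}^n:a(\alpha)\neq0\}$ and $\mathcal{M}(f)$ is the set of minimal elements of $\mathrm{supp}(f)$ with respect to the componentwise partial order on $\mathbb{N}^n$. For $\mathcal{M}\subset\mathbb{N}^n$ and $\ell\in\mathbb{N}$, $\mathcal{M}_\ell=\{\alpha+\beta:\alpha\in\mathcal{M},\ \beta\in\mathbb{N}^n,\ |\beta|\le\ell\}$ where $|\beta|=\sum\beta_i$. *)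

(* Defs.v *)
From HB Require Import structures.
From mathcomp Require Import all_boot all_order all_algebra.
From mathcomp Require Import reals sequences exp.
From mathcomp.real_closed Require Import complex.
From mathcomp Require Import finmap.
From mathcomp Require Import mpoly.

Set Implicit Arguments. Unset Strict Implicit. Unset Printing Implicit Defensive.
Import Order.TTheory GRing.Theory Num.Theory.
Local Open Scope ring_scope.

Notation mon n := (mpoly.multinom n).

Definition le_cw n (a b : mon n) : Prop := forall i : 'I_n, (mpoly.fun_of_multinom a i <= mpoly.fun_of_multinom b i)%N.

Definition absm n (b : mon n) : nat := (\sum_(i < n) mpoly.fun_of_multinom b i)%N.

Definition supp (R : realType) n (f : mpoly.mpoly n R[i]) : mon n -> Prop :=
  fun a => mpoly.mcoeff a f != 0.

Definition in_minimal (R : realType) n (f : mpoly.mpoly n R[i]) (a : mon n) : Prop :=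
  supp f a /\ forall b, supp f b -> le_cw b a -> b = a.

Definition minimal_set_is (R : realType) n (f : mpoly.mpoly n R[i])
  (M : {fset mon n}) : Prop :=
  forall a, a \in M <-> in_minimal f a.

Definition in_Ml n (M : {fset mon n}) (l : nat) (g : mon n) : Prop :=
  exists2 a, a \in M & exists b : mon n, (absm b <= l)%N /\ g = mpoly.mnm_add a b.

Definition stable (R : realType) n (f : mpoly.mpoly n R[i]) : Prop :=
  forall z : 'I_n -> R[i], (forall i, 0 < Im (z i)) -> mpoly.meval z f != 0.

Definition coefs (R : realType) n (f : mpoly.mpoly n R[i]) : mon n -> R[i] :=
  fun a => mpoly.mcoeff a f.

Definition admissible (R : realType) n (M : {fset mon n}) (c : mon n -> R[i]) : Prop :=
  exists f : mpoly.mpoly n R[i], [/\ stable f, minimal_set_is f M & c = coefs f].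

Definition cabs (R : realType) (z : R[i]) : R := ComplexField.Normc.normc z.

(* Main.v *)
(* Write u = log |f|.  For a univariate stable polynomial h all roots lie in the
   closed lower half-plane, so an inequality between products of distances to one
   such root transfers to h.  Three instances, applied along complex lines, are used:
   - |h(-i)| <= |h(i)|, so |f(x + iy)| <= |f(x + iY)| whenever |y_j| <= Y_j;
   - |h(1) h(-1)| <= |h(i)|^2, so |f(p + w) f(p - w)| <= |f(p + iw)|^2 for w >= 0;
   - |h(0)|^2 <= |h(-r + ir) h(r + ir)|, a lower bound on rays.
   For |z_j| <= r take p = - r + 3ir and w = Re z + r: they bound |f(z)| by values of
   |f| on rays t v with 1 <= v_j <= 3, where t |-> f(t v) = t^m (c_0(v) + c_1(v) t + ...)
   obeys Szasz's inequality, m being the least degree in M.  The exponents of c_0, c_1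
   and c_2 lie in M_2.  Finally |c_0(v)| >= |c_0(1,...,1)| by the first instance, and
   c_0(1,...,1) <> 0, since otherwise c_0 would vanish on the box (0,1]^n. *)
Require Import Defs.
From HB Require Import structures.
From mathcomp Require Import all_boot all_order all_algebra.
From mathcomp Require Import reals sequences exp.
From mathcomp.real_closed Require Import complex.
From mathcomp Require Import finmap.
From mathcomp Require Import mpoly.
From mathcomp Require Import ring lra.
From mathcomp Require Import boolp.
Set Implicit Arguments. Unset Strict Implicit. Unset Printing Implicit Defensive.
Import Order.TTheory GRing.Theory Num.Theory.
Local Open Scope ring_scope.

Local Notation cRe := complex.Re.
Local Notation cIm := complex.Im.

(** * The modulus on [R[i]] *)

Lemma cabs_ge0 (R : realType) (z : R[i]) : 0 <= cabs z.
Proof. by case: z => a b; rewrite /cabs /= sqrtr_ge0. Qed.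

Lemma cabs_sqr (R : realType) (z : R[i]) : cabs z ^+ 2 = cRe z ^+ 2 + cIm z ^+ 2.
Proof. by case: z => a b; rewrite /cabs /= sqr_sqrtr // addr_ge0 ?sqr_ge0. Qed.

Lemma cabs0 (R : realType) : cabs (0 : R[i]) = 0.
Proof. exact: Normc.normc0. Qed.

Lemma cabs1 (R : realType) : cabs (1 : R[i]) = 1.
Proof. exact: Normc.normc1. Qed.

Lemma cabsM (R : realType) (x y : R[i]) : cabs (x * y) = cabs x * cabs y.
Proof. exact: Normc.normcM. Qed.

Lemma cabsN (R : realType) (x : R[i]) : cabs (- x) = cabs x.
Proof. exact: normcN. Qed.

Lemma cabsD (R : realType) (x y : R[i]) : cabs (x + y) <= cabs x + cabs y.
Proof. exact: le_normcD. Qed.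

Lemma cabsX (R : realType) (x : R[i]) k : cabs (x ^+ k) = cabs x ^+ k.
Proof. by elim: k => [|k IH]; rewrite ?expr0 ?cabs1 // !exprS cabsM IH. Qed.

Lemma cabs_eq0 (R : realType) (x : R[i]) : (cabs x == 0) = (x == 0).
Proof.
by apply/eqP/eqP => [/Normc.eq0_normc|->] //; rewrite cabs0.
Qed.

Lemma cabs_gt0 (R : realType) (x : R[i]) : (0 < cabs x) = (x != 0).
Proof. by rewrite lt0r cabs_ge0 andbT cabs_eq0. Qed.

Lemma cabs_prod (R : realType) (I : Type) (s : seq I) (P : pred I) (F : I -> R[i]) :
  cabs (\prod_(j <- s | P j) F j) = \prod_(j <- s | P j) cabs (F j).
Proof. by apply: (big_morph (@cabs R)); [exact: cabsM | exact: cabs1]. Qed.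

Lemma cabs_sum (R : realType) (I : Type) (s : seq I) (P : pred I) (F : I -> R[i]) :
  cabs (\sum_(j <- s | P j) F j) <= \sum_(j <- s | P j) cabs (F j).
Proof.
elim: s => [|j s IH]; first by rewrite !big_nil cabs0.
rewrite !big_cons; case: (P j); rewrite //=.
by apply: (le_trans (@cabsD R _ _)); rewrite lerD2l.
Qed.

Lemma cabs_real (R : realType) (x : R) : cabs (x%:C)%C = `|x|.
Proof. by rewrite /cabs /= expr0n addr0 sqrtr_sqr. Qed.

Lemma Re_le_cabs (R : realType) (z : R[i]) : `|cRe z| <= cabs z.
Proof.
rewrite -(@ler_pXn2r _ 2) ?nnegrE ?cabs_ge0 ?normr_ge0 //.
by rewrite cabs_sqr real_normK ?num_real // lerDl sqr_ge0.
Qed.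

Lemma Im_le_cabs (R : realType) (z : R[i]) : `|cIm z| <= cabs z.
Proof.
rewrite -(@ler_pXn2r _ 2) ?nnegrE ?cabs_ge0 ?normr_ge0 //.
by rewrite cabs_sqr real_normK ?num_real // lerDr sqr_ge0.
Qed.

Lemma ler_cabs (R : realType) (x y : R[i]) :
  (cabs x <= cabs y) = (cRe x ^+ 2 + cIm x ^+ 2 <= cRe y ^+ 2 + cIm y ^+ 2).
Proof. by rewrite -!cabs_sqr ler_pXn2r ?nnegrE ?cabs_ge0. Qed.

(** * Univariate stable polynomials *)

Definition stable1 (R : realType) (h : {poly R[i]}) : Prop :=
  forall t : R[i], 0 < cIm t -> h.[t] != 0.

Lemma stable1_roots (R : realType) (h : {poly R[i]}) : stable1 h ->
  exists s : seq R[i], (forall z, z \in s -> cIm z <= 0) /\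
    h = lead_coef h *: \prod_(z <- s) ('X - z%:P).
Proof.
move=> hs; have [s hE] := closed_field_poly_normal h.
have h0 : lead_coef h != 0.
  rewrite lead_coef_eq0; apply/eqP => h0.
  have /eqP := hs (0 +i* 1)%C ltr01; by rewrite h0 horner0.
exists s; split => // z zs; rewrite leNgt; apply/negP => /hs.
suff -> : h.[z] = 0 by rewrite eqxx.
rewrite hE hornerZ horner_prod; apply/eqP; rewrite mulf_eq0 (negPf h0) /=.
by rewrite prodf_seq_eq0; apply/hasP; exists z => //=; rewrite !hornerE subrr.
Qed.

(* Both sides factor over the roots of [h], which lie in the closed lower half-plane. *)
Lemma stable1_le (R : realType) (h : {poly R[i]}) (a1 a2 b1 b2 : R[i]) :
  stable1 h ->
  (forall z : R[i], cIm z <= 0 ->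
     cabs ((a1 - z) * (a2 - z)) <= cabs ((b1 - z) * (b2 - z))) ->
  cabs (h.[a1] * h.[a2]) <= cabs (h.[b1] * h.[b2]).
Proof.
move=> /stable1_roots[s [sP ->]] H.
set c := lead_coef h.
have E a b : (c *: \prod_(z <- s) ('X - z%:P)).[a] * (c *: \prod_(z <- s) ('X - z%:P)).[b]
    = c ^+ 2 * \prod_(z <- s) ((a - z) * (b - z)).
  rewrite !hornerZ !horner_prod big_split /= mulrACA -expr2; congr (_ * (_ * _));
  by apply: eq_bigr => z _; rewrite !hornerE.
rewrite !E !cabsM ler_wpM2l ?mulr_ge0 ?cabs_ge0 // !cabs_prod.
rewrite !big_seq; apply: ler_prod => z zs.
by rewrite cabs_ge0 H // sP.
Qed.

(** A root in the closed lower half-plane is at least as close to [-i] as to [i]. Squaring puts the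
    claim in the two-point form of [stable1_le]. *)
Lemma stable1_reflect (R : realType) (h : {poly R[i]}) : stable1 h ->
  cabs h.[(0 -i* 1)%C] <= cabs h.[(0 +i* 1)%C].
Proof.
move=> hs; rewrite -(@ler_pXn2r _ 2) ?nnegrE ?cabs_ge0 //.
rewrite -!cabsX !expr2; apply: stable1_le => // z z0.
rewrite -!expr2 !cabsX ler_pXn2r ?nnegrE ?cabs_ge0 // ler_cabs.
by case: z z0 => x y /= z0; nra.
Qed.

(** For a root [z = x + iy], [|(1 - z)(-1 - z)|^2 = (1 + |z|^2)^2 - 4 x^2], while
    [|i - z|^2 = 1 + |z|^2 - 2 y] with [y <= 0]. *)
Lemma stable1_mul_real (R : realType) (h : {poly R[i]}) : stable1 h ->
  cabs (h.[1] * h.[-1]) <= cabs h.[(0 +i* 1)%C] ^+ 2.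
Proof.
move=> hs; rewrite -cabsX expr2; apply: stable1_le => // z z0.
rewrite ler_cabs; case: z z0 => x y /= y0.
nra.
Qed.

Lemma stable1_mul_diag (R : realType) (q : {poly R[i]}) (r : R) : stable1 q -> 0 <= r ->
  cabs q.[0] ^+ 2 <= cabs (q.[(- r +i* r)%C] * q.[(r +i* r)%C]).
Proof.
move=> qs r0; rewrite -cabsX expr2; apply: stable1_le => // z z0.
rewrite ler_cabs; case: z z0 => x y /= y0.
have [a [a0 ->]] : exists a, 0 <= a /\ y = - a by exists (- y); rewrite opprK oppr_ge0.
rewrite -subr_ge0; set e := (X in 0 <= X).
(* With [y = - a], the difference of the squared moduli expands into terms that are non-negative for
   [r, a >= 0]. *)
have -> : e = 2 * x ^+ 2 * (2 * (r * a)) + 2 * a ^+ 2 * (2 * (r * a) + r ^+ 2)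
    + (2 * (r * a) + r ^+ 2) ^+ 2 + 2 * r ^+ 2 * (a + r) ^+ 2 + r ^+ 4.
  by rewrite /e; ring.
have ra : 0 <= r * a by exact: mulr_ge0.
by repeat first [exact: sqr_ge0 | assumption | exact: ler0n | apply: addr_ge0
  | apply: mulr_ge0 | apply: exprn_ge0].
Qed.

(** * Reciprocal roots and the growth of stable polynomials in one variable *)

Lemma prod_linear_normal (R : realType) (s : seq R[i]) :
  (forall z, z \in s -> z != 0 /\ cIm z <= 0) ->
  exists c (m : seq R[i]), (forall z, z \in m -> 0 <= cIm z) /\
    \prod_(z <- s) ('X - z%:P) = c *: \prod_(z <- m) (1 - z *: 'X).
Proof.
elim: s => [|z s IH] H.
  by exists 1, [::]; split=> //; rewrite !big_nil scale1r.
have [z0 zI] := H z (mem_head _ _).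
have [w ws|c [m [mP E]]] := IH; first by apply: H; rewrite inE ws orbT.
(* ['X - z = - z (1 - z^-1 'X)], and inversion sends the punctured closed lower half-plane into the
   closed upper one. *)
exists (- z * c), (z^-1 :: m); split.
  move=> w; rewrite inE => /orP[/eqP ->|]; last exact: mP.
  case: z z0 zI {H} => x y _ /= yI; rewrite oppr_ge0.
  by rewrite mulr_le0_ge0 // invr_ge0 addr_ge0 ?sqr_ge0.
rewrite !big_cons E -!mul_polyC polyCM mulrACA; congr (_ * _).
by rewrite mulrBr mulr1 mulrA -polyCM mulNr divff // !polyCN mulNr mul1r opprK addrC.
Qed.

Lemma stable1_normal (R : realType) (q : {poly R[i]}) : stable1 q -> q`_0 != 0 ->
  exists m : seq R[i], (forall z, z \in m -> 0 <= cIm z) /\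
    q = q`_0 *: \prod_(z <- m) (1 - z *: 'X).
Proof.
move=> /stable1_roots[s [sP qE]] q0.
have [z zs|c [m [mP E]]] := @prod_linear_normal R s.
  split; last exact: sP.
  apply: contraNneq q0 => z0; rewrite -horner_coef0 qE hornerZ horner_prod mulf_eq0.
  rewrite prodf_seq_eq0; apply/orP; right; apply/hasP; exists z => //=.
  by rewrite z0 hornerXsubC subrr.
exists m; split=> //; rewrite {1}qE E scalerA; congr (_ *: _).
rewrite -horner_coef0 {2}qE E !hornerZ horner_prod big1 ?mulr1 // => z _.
by rewrite !hornerE ?mulr0 ?subr0.
Qed.

(** Newton's identities: the coefficients are signed elementary symmetric functions of [m], here
    expressed through power sums. *)
Lemma prod_one_minus_coef (R : realType) (m : seq R[i]) :
  let P := \prod_(z <- m) (1 - z *: 'X) : {poly R[i]} in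
  [/\ P`_0 = 1, P`_1 = - \sum_(z <- m) z &
      2 * P`_2 = (\sum_(z <- m) z) ^+ 2 - \sum_(z <- m) z ^+ 2].
Proof.
elim: m => [|z m /= [E0 E1 E2]].
  rewrite /= !big_nil !coef1 /=; split; rewrite ?oppr0 // expr2 !mulr0 addr0 //.
rewrite /= !big_cons mulrBl mul1r -scalerAl !coefB !coefZ !coefXM /= E0 E1 mulr0 subr0 mulr1.
split=> //.
  by rewrite opprD addrC.
rewrite mulrBr E2; ring.
Qed.

(** Factor by factor: [|1 - t z|^2 = 1 - 2 Re(t z) + |t z|^2], and [1 + x <= exp x]. *)
Lemma prod_one_minus_le (R : realType) (m : seq R[i]) (t : R[i]) :
  cabs (\prod_(z <- m) (1 - z *: 'X)).[t] ^+ 2 <=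
  expR (- (2 * cRe (t * \sum_(z <- m) z)) + cabs t ^+ 2 * \sum_(z <- m) cabs z ^+ 2).
Proof.
elim: m => [|z m IH].
  by rewrite !big_nil hornerC cabs1 !mulr0 /= ?mulr0 ?oppr0 addr0 expR0 expr1n.
rewrite !big_cons hornerM cabsM exprMn; move: IH.
set S := \sum_(j <- m) j; set S2 := \sum_(j <- m) cabs j ^+ 2 => IH.
have -> : - (2 * cRe (t * (z + S))) + cabs t ^+ 2 * (cabs z ^+ 2 + S2)
   = (- (2 * cRe (t * z)) + cabs t ^+ 2 * cabs z ^+ 2) +
     (- (2 * cRe (t * S)) + cabs t ^+ 2 * S2).
  by rewrite !cabs_sqr; move: (t) (z) (S) => [a b] [x y] [u v] /=; ring.
rewrite expRD ler_pM ?sqr_ge0 //.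
apply: le_trans (expR_ge1Dx _); rewrite hornerD hornerN hornerZ hornerX hornerC !cabs_sqr.
by move: (t) z => [a b] [x y] /=; rewrite le_eqVlt; apply/orP; left; apply/eqP; ring.
Qed.

(** Termwise [|z|^2 = Re(z^2) + 2 (Im z)^2], and for non-negative imaginary parts the sum of the
    squares is at most the square of the sum. The second conjunct gives the sign of the cross term
    in the induction. *)
Lemma sum_cabs_sqr_le (R : realType) (m : seq R[i]) :
  (forall z, z \in m -> 0 <= cIm z) ->
  \sum_(z <- m) cabs z ^+ 2 <=
  cRe (\sum_(z <- m) z ^+ 2) + 2 * cIm (\sum_(z <- m) z) ^+ 2 /\ 0 <= cIm (\sum_(z <- m) z).
Proof.
elim: m => [|z m IH] H; first by rewrite !big_nil /= expr0n mulr0 addr0.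
have [w wm|I1 I2] := IH; first by apply: H; rewrite inE wm orbT.
have zI := H z (mem_head _ _).
rewrite !big_cons cabs_sqr; move: (\sum_(j <- m) j) I1 I2 zI {IH H} => [u v].
move: (\sum_(j <- m) j ^+ 2) z => [u' v'] [x y] /=; nra.
Qed.

(* Szasz's inequality *)
Lemma stable1_growth (R : realType) (q : {poly R[i]}) (t : R[i]) : stable1 q -> q`_0 != 0 ->
  cabs q.[t] <= cabs q`_0 *
    expR (2^-1 + cabs t ^+ 2 * (2 * (cabs q`_1 / cabs q`_0) ^+ 2 + cabs q`_2 / cabs q`_0)).
Proof.
move=> qs q0; have [m [mP qE]] := stable1_normal qs q0.
set c := q`_0 in q0 qE *.
have [_ P1 P2] := prod_one_minus_coef m.
have [H1 H2] := sum_cabs_sqr_le mP.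
have H3 := prod_one_minus_le m t.
rewrite qE !coefZ hornerZ !cabsM.
rewrite ler_wpM2l ?cabs_ge0 //.
set P := \prod_(z <- m) _ in P1 P2 H3 *.
have cp : cabs c != 0 by rewrite cabs_eq0.
rewrite ![cabs c * _]mulrC !mulfK // -(@ler_pXn2r _ 2) ?nnegrE ?cabs_ge0 ?expR_ge0 //.
apply: le_trans H3 _.
rewrite -expRM_natl ler_expR P1 cabsN.
set S := \sum_(z <- m) z in P1 P2 H1 H2 *.
set S2 := \sum_(z <- m) z ^+ 2 in P2 H1 *.
(* [2 u <= 1 + u^2] for [u = |t S|]. *)
have A1 : - (2 * cRe (t * S)) <= 1 + cabs t ^+ 2 * cabs S ^+ 2.
  have : - cRe (t * S) <= cabs (t * S).
    by apply: le_trans (@Re_le_cabs R _); rewrite -normrN ler_norm.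
  rewrite -exprMn -cabsM; move: (cabs _) (cRe _) => u v uv.
  have : 0 <= (1 - u) ^+ 2 by exact: sqr_ge0.
  nra.
(* Newton's identity and [|Im S| <= |S|] eliminate the power sum [S2]. *)
have A2 : \sum_(z <- m) cabs z ^+ 2 <= 3 * cabs S ^+ 2 + 2 * cabs P`_2.
  have -> : 2 * cabs P`_2 = cabs (2 * P`_2).
    by rewrite cabsM -[2 in RHS](rmorph_nat (@real_complex R)) cabs_real ger0_norm.
  apply: le_trans H1 _.
  have -> : S2 = S ^+ 2 - 2 * P`_2 by rewrite P2; ring.
  have B1 : cRe (S ^+ 2 - 2 * P`_2) <= cabs S ^+ 2 + cabs (2 * P`_2).
    apply: le_trans (ler_norm _) _; apply: (le_trans (@Re_le_cabs R _)).
    by apply: (le_trans (@cabsD R _ _)); rewrite cabsN cabsX.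
  have B2 : cIm S ^+ 2 <= cabs S ^+ 2 by rewrite cabs_sqr lerDr sqr_ge0.
  lra.
(* With [p2] the modulus of the coefficient of degree 2, the exponent of the squared bound is at
   most [1 + T (U + 3 U + 2 p2)], twice the exponent claimed. *)
have := ler_wpM2l (sqr_ge0 (cabs t)) A2.
move: A1; set T := cabs t ^+ 2; set U := cabs S ^+ 2; lra.
Qed.

(** * Restriction to lines *)

Definition cpt (R : realType) n (x y : 'I_n -> R) : 'I_n -> R[i] :=
  fun j => (x j +i* y j)%C.

Lemma stable_neq0 (R : realType) n (f : {mpoly R[i][n]}) (z : 'I_n -> R[i]) :
  stable f -> (forall j, 0 < cIm (z j)) -> f.@[z] != 0.
Proof. by move=> fs zI; apply: fs => j; rewrite -complexIm ltcR. Qed.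

Definition line (R : realType) n (f : {mpoly R[i][n]}) (p v : 'I_n -> R[i]) : {poly R[i]} :=
  \sum_(a <- msupp f) f@_a *: \prod_j ((p j)%:P + v j *: 'X) ^+ a j.

Lemma line_eval (R : realType) n (f : {mpoly R[i][n]}) (p v : 'I_n -> R[i]) (t : R[i]) :
  (line f p v).[t] = f.@[fun j => p j + v j * t].
Proof.
rewrite mevalE horner_sum; apply: eq_bigr => a _.
rewrite hornerZ horner_prod; congr (_ * _); apply: eq_bigr => j _.
by rewrite horner_exp hornerD hornerC hornerZ hornerX.
Qed.

Lemma stable_line (R : realType) n (f : {mpoly R[i][n]}) (p v : 'I_n -> R[i]) : stable f ->
  (forall j t, 0 < cIm t -> 0 < cIm (p j + v j * t)) -> stable1 (line f p v).
Proof. by move=> fs H t t0; rewrite line_eval; apply: stable_neq0 => // j; apply: H. Qed.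

Lemma stable_le_Im (R : realType) n (f : {mpoly R[i][n]}) (x y Y : 'I_n -> R) : stable f ->
  (forall j, 0 < Y j) -> (forall j, `|y j| <= Y j) ->
  cabs f.@[cpt x y] <= cabs f.@[cpt x Y].
Proof.
move=> fs Y0 yY.
(* The parameters [-i] and [i] on this line give [x + iy] and [x + iY]. The numbers [(Y + y) / 2]
   and [(Y - y) / 2] are non-negative with sum [Y > 0], so parameters in the upper half-plane give
   points with all coordinates there. *)
pose h := line f (cpt x (fun j => (Y j + y j) / 2)) (cpt (fun j => (Y j - y j) / 2) (fun=> 0)).
have hs : stable1 h.
  apply: stable_line => // j [a b] /= b0.
  have := yY j; rewrite ler_norml => /andP[y1 y2].
  have := Y0 j; rewrite mul0r addr0; nra.
have := stable1_reflect hs; rewrite !line_eval.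
have -> : (fun j => cpt x (fun j => (Y j + y j) / 2) j +
   cpt (fun j => (Y j - y j) / 2) (fun=> 0) j * (0 -i* 1)%C) = cpt x y.
  by apply: funext => j; apply/eqP; rewrite eq_complex /=; apply/andP; split; apply/eqP; field.
suff -> : (fun j => cpt x (fun j => (Y j + y j) / 2) j +
   cpt (fun j => (Y j - y j) / 2) (fun=> 0) j * (0 +i* 1)%C) = cpt x Y by [].
by apply: funext => j; apply/eqP; rewrite eq_complex /=; apply/andP; split; apply/eqP; field.
Qed.

(** This is [stable1_mul_real] on the line [x + iy + t w], at [t = 1], [-1] and [i]. *)
Lemma stable_mul_real (R : realType) n (f : {mpoly R[i][n]}) (x y w : 'I_n -> R) : stable f ->
  (forall j, 0 < y j) -> (forall j, 0 <= w j) ->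
  cabs f.@[cpt (x \+ w) y] * cabs f.@[cpt (x \- w) y] <=
  cabs f.@[cpt x (y \+ w)] ^+ 2.
Proof.
move=> fs y0 w0.
have hs : stable1 (line f (cpt x y) (cpt w (fun=> 0))).
  apply: stable_line => // j [a b] /= b0.
  have := y0 j; have := w0 j; rewrite mul0r addr0; nra.
have := stable1_mul_real hs; rewrite cabsM !line_eval.
have E (a b : R) : (fun j => cpt x y j + cpt w (fun=> 0) j * (a +i* b)%C) =
    cpt (fun j => x j + w j * a) (fun j => y j + w j * b).
  by apply: funext => j; apply/eqP; rewrite eq_complex /=; apply/andP; split; apply/eqP; ring.
have -> : -1 = (-1 +i* 0)%C :> R[i] by apply/eqP; rewrite eq_complex /= oppr0 !eqxx.
have -> : 1 = (1 +i* 0)%C :> R[i] by [].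
rewrite !E; set z1 := cpt _ _; set z2 := cpt _ _; set z3 := cpt _ _.
suff [-> -> ->] : [/\ z1 = cpt (x \+ w) y, z2 = cpt (x \- w) y & z3 = cpt x (y \+ w)] by [].
by split; apply: funext => j; rewrite /z1 /z2 /z3 /cpt /= ?(mulr0, mulr1, addr0, mulrN1).
Qed.

(** The homogeneous component of degree [k] at a real point; [hpart f (m + k) v] is the Taylor
    coefficient [c_k(v)] of the ray through [v]. *)
Definition hpart (R : realType) n (f : {mpoly R[i][n]}) (k : nat) (v : 'I_n -> R) : R[i] :=
  \sum_(a <- msupp f | mdeg a == k) f@_a * \prod_j (v j)%:C%C ^+ a j.

Definition ray (R : realType) n (f : {mpoly R[i][n]}) (v : 'I_n -> R) : {poly R[i]} :=
  line f (fun=> 0) (fun j => (v j)%:C%C).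

Lemma ray_eval (R : realType) n (f : {mpoly R[i][n]}) (v : 'I_n -> R) (a b : R) :
  (ray f v).[(a +i* b)%C] = f.@[cpt (fun j => v j * a) (fun j => v j * b)].
Proof.
rewrite line_eval; congr (meval _ f); apply: funext => j.
by apply/eqP; rewrite eq_complex /=; apply/andP; split; apply/eqP; ring.
Qed.

Lemma stable_ray (R : realType) n (f : {mpoly R[i][n]}) (v : 'I_n -> R) : stable f ->
  (forall j, 0 < v j) -> stable1 (ray f v).
Proof.
move=> fs v0; apply: stable_line => // j [a b] /= b0.
by rewrite add0r mul0r addr0 mulr_gt0.
Qed.

Lemma coef_ray (R : realType) n (f : {mpoly R[i][n]}) (v : 'I_n -> R) (k : nat) :
  (ray f v)`_k = hpart f k v.
Proof.
rewrite /ray /line coef_sum /hpart [RHS]big_mkcond; apply: eq_bigr => a _.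
rewrite coefZ.
have -> : \prod_j ((0 : R[i])%:P + (v j)%:C%C *: 'X) ^+ a j =
    (\prod_j (v j)%:C%C ^+ a j) *: 'X^(mdeg a) :> {poly R[i]}.
  under eq_bigr do rewrite polyC0 add0r exprZn -mul_polyC.
  by rewrite big_split /= -rmorph_prod /= mul_polyC prodrXr mdegE.
by rewrite coefZ coefXn eq_sym; case: eqP; rewrite ?mulr1 ?mulr0.
Qed.

(** Splits off the zero at the origin, so that the cofactor has the lowest homogeneous part as
    constant term. *)
Lemma ray_factor (R : realType) n (f : {mpoly R[i][n]}) (m : nat) (v : 'I_n -> R) :
  (forall a, a \in msupp f -> (m <= mdeg a)%N) ->
  ray f v = drop_poly m (ray f v) * 'X^m.
Proof.
move=> H; rewrite -[LHS](poly_take_drop m); rewrite (_ : take_poly m _ = 0) ?add0r //.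
apply/polyP => k; rewrite coef_take_poly coef0; case: ltnP => // km.
rewrite coef_ray /hpart big_seq_cond big1 // => a /andP[/H am /eqP ak].
by rewrite -ak ltnNge am in km.
Qed.

(** * The lowest homogeneous part *)

(** A Lipschitz bound at 0 along the imaginary axis, by Horner recursion; it serves as continuity
    when letting [t] tend to 0. *)
Lemma poly_near0 (R : realType) (p : {poly R[i]}) : exists K : R, 0 <= K /\
  forall t : R, 0 < t -> t <= 1 -> cabs (p.[(0 +i* t)%C] - p.[0]) <= K * t.
Proof.
elim/poly_ind: p => [|p c [K [K0 H]]].
  by exists 0; split=> // t _ _; rewrite !horner0 subrr cabs0 mul0r.
exists (cabs p.[0] + K); split=> [|t t0 t1]; first by rewrite addr_ge0 ?cabs_ge0.
rewrite !hornerMXaddC mulr0 add0r addrK cabsM.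
have -> : cabs (0 +i* t)%C = t.
  by rewrite /cabs /= expr0n add0r sqrtr_sqr gtr0_norm.
rewrite ler_wpM2r ?(ltW t0) //.
have := @cabsD R (p.[(0 +i* t)%C] - p.[0]) p.[0].
have Kt : K * t <= K by rewrite ler_piMr.
rewrite subrK; have := H t t0 t1; lra.
Qed.

Lemma poly_le_at0 (R : realType) (p q : {poly R[i]}) :
  (forall t : R, 0 < t -> cabs p.[(0 +i* t)%C] <= cabs q.[(0 +i* t)%C]) ->
  cabs p.[0] <= cabs q.[0].
Proof.
move=> H; have [K [K0 HK]] := poly_near0 p; have [L [L0 HL]] := poly_near0 q.
rewrite leNgt; apply/negP => lt.
set d := cabs p.[0] - cabs q.[0]; have d0 : 0 < d by rewrite subr_gt0.
have s0 : 0 < d + K + L + 1 by lra.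
(* Chosen so that [(K + L) t = d - t d - t < d], although the hypothesis at this [t] forces
   [d <= (K + L) t]. *)
pose t := d / (d + K + L + 1).
have t0 : 0 < t by rewrite divr_gt0.
have t1 : t <= 1 by rewrite ler_pdivrMr // mul1r; lra.
have tE : t * (d + K + L + 1) = d by rewrite divfK // gt_eqF.
have A1 : cabs p.[0] <= cabs p.[(0 +i* t)%C] + K * t.
  have := @cabsD R (p.[0] - p.[(0 +i* t)%C]) p.[(0 +i* t)%C].
  rewrite subrK -(cabsN (p.[0] - _)) opprB; have := HK t t0 t1; lra.
have A2 : cabs q.[(0 +i* t)%C] <= cabs q.[0] + L * t.
  have := @cabsD R (q.[(0 +i* t)%C] - q.[0]) q.[0].
  rewrite subrK; have := HL t t0 t1; lra.
have A3 := H t t0.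
have : d <= (K + L) * t by rewrite /d; lra.
have : 0 < t * d by exact: mulr_gt0.
nra.
Qed.

(** At the parameter [i t] both rays have zero real parts and ordered imaginary parts, so
    [stable_le_Im] compares them. Dividing by [t^m] and letting [t] tend to 0 leaves the lowest
    parts. *)
Lemma hpart_mono (R : realType) n (f : {mpoly R[i][n]}) (m : nat) (w v : 'I_n -> R) :
  stable f -> (forall a, a \in msupp f -> (m <= mdeg a)%N) ->
  (forall j, 0 < w j) -> (forall j, w j <= v j) ->
  cabs (hpart f m w) <= cabs (hpart f m v).
Proof.
move=> fs fm w0 wv.
have E u : hpart f m u = (drop_poly m (ray f u)).[0].
  by rewrite horner_coef0 coef_drop_poly add0n coef_ray.
rewrite !E; apply: poly_le_at0 => t t0.
have tm : 0 < cabs ((0 +i* t)%C ^+ m).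
  by rewrite cabs_gt0 expf_neq0 // eq_complex /= (gt_eqF t0) andbF.
have F u : cabs (drop_poly m (ray f u)).[(0 +i* t)%C] * cabs ((0 +i* t)%C ^+ m) =
    cabs (ray f u).[(0 +i* t)%C].
  by rewrite [in RHS](ray_factor u fm) hornerM hornerXn cabsM.
rewrite -(ler_pM2r tm) !F !ray_eval.
have -> : (fun j => w j * 0) = (fun j => v j * 0) by apply: funext => j; rewrite !mulr0.
have v0 j : 0 < v j by exact: lt_le_trans (w0 j) (wv j).
apply: stable_le_Im => // j; first exact: mulr_gt0.
have [t0' w0'] := (ltW t0, ltW (w0 j)).
by rewrite ger0_norm ?mulr_ge0 // ler_wpM2r.
Qed.

(** Base [K] expansions: reduction modulo [K] recovers the lowest digit, and cancelling it allows
    division by [K]. *)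
Lemma digits_inj (K n : nat) (a b : 'I_n -> nat) :
  (forall j, a j < K)%N -> (forall j, b j < K)%N ->
  (\sum_j a j * K ^ j = \sum_j b j * K ^ j)%N -> a =1 b.
Proof.
elim: n a b => [|n IH] a b aK bK; first by move=> _ [].
have E (c : 'I_n.+1 -> nat) :
    (\sum_j c j * K ^ j = \sum_(j < n) c (lift ord0 j) * K ^ j * K + c ord0)%N.
  rewrite big_ord_recl expn0 muln1 addnC; congr (_ + _)%N.
  by apply: eq_bigr => j _; rewrite /= /bump /= add1n expnSr mulnA.
rewrite !E -!big_distrl /= => eqab.
have K0 : (0 < K)%N by exact: leq_ltn_trans (aK ord0).
have e0 : a ord0 = b ord0.
  by have := congr1 (modn^~ K) eqab; rewrite !modnMDl !modn_small.
move: eqab; rewrite e0 => /addIn/eqP; rewrite eqn_pmul2r // => /eqP eS j.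
have [k ->|->] := unliftP ord0 j; last exact: e0.
by apply: (IH (a \o lift ord0) (b \o lift ord0)) => // i; [exact: aK | exact: bK].
Qed.

Lemma poly_eq0_unit_interval (R : realType) (P : {poly R[i]}) :
  (forall y : R, 0 < y -> y <= 1 -> P.[y%:C%C] = 0) -> P = 0.
Proof.
move=> H; apply: contraTeq isT => P0.
(* [size P] distinct points of the interval, one more than the degree allows as roots. *)
pose s := [seq (k.+1%:R^-1 : R)%:C%C | k <- iota 0 (size P)].
have /= := max_poly_roots P0 (_ : all (root P) s) (_ : uniq s).
rewrite size_map size_iota ltnn; apply.
  apply/allP => _ /mapP[k _ ->]; apply/rootP; apply: H; first by rewrite invr_gt0 ltr0n.
  by rewrite invf_le1 ?ltr0n // ler1n.
rewrite map_inj_uniq ?iota_uniq // => k l [] /invr_inj /eqP.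
by rewrite eqr_nat eqSS => /eqP.
Qed.

(* Kronecker substitution [v j = y ^ (K ^ j)] separates the monomials of degree [m < K]. *)
Lemma hpart_eq0 (R : realType) n (f : {mpoly R[i][n]}) (m : nat) :
  (forall w, (forall j, 0 < w j) -> (forall j, w j <= 1) -> hpart f m w = 0) ->
  forall a, mdeg a = m -> f@_a = 0.
Proof.
move=> H a am; pose K := m.+1.
pose code (b : 'X_{1..n}) := (\sum_j b j * K ^ j)%N.
pose P : {poly R[i]} := \sum_(b <- msupp f | mdeg b == m) f@_b *: 'X^(code b).
have P0 : P = 0.
  apply: poly_eq0_unit_interval => y y0 y1.
  rewrite -(H (fun j => y ^+ (K ^ j))); last 2 first.
  - by move=> j; exact: exprn_gt0.
  - by move=> j; exact: exprn_ile1 (ltW y0) y1.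
  rewrite horner_sum /hpart; apply: eq_bigr => b _.
  rewrite hornerZ hornerXn -prodrXr; congr (_ * _); apply: eq_bigr => j _.
  by rewrite mulnC exprM -rmorphXn.
have bK (b : 'X_{1..n}) j : mdeg b = m -> (b j < K)%N.
  by rewrite /K ltnS => <-; rewrite mdegE (bigD1 j) //= leq_addr.
have [af|/memN_msupp_eq0 //] := boolP (a \in msupp f).
(* Codes of distinct exponents of degree [m] differ, so this coefficient of [P] is that of [a] in
   [f] alone. *)
have := congr1 (fun p : {poly R[i]} => p`_(code a)) P0.
rewrite coef0 coef_sum -big_filter (bigD1_seq a) /=; last 2 first.
- by rewrite mem_filter am eqxx.
- exact: filter_uniq (msupp_uniq f).
rewrite coefZ coefXn eqxx mulr1 big_seq_cond big1 ?addr0 // => b /andP[].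
rewrite mem_filter => /andP[/eqP bm _] ba; rewrite coefZ coefXn.
case: eqP => [e|_]; last by rewrite mulr0.
case/eqP: ba; apply/mnmP => j; apply: (@digits_inj K) => [k|k|]; first exact: bK.
  exact: bK.
by rewrite -/(code a) -/(code b) e.
Qed.

Lemma hpart1_neq0 (R : realType) n (f : {mpoly R[i][n]}) (m : nat) (a : 'X_{1..n}) :
  stable f -> (forall b, b \in msupp f -> (m <= mdeg b)%N) ->
  a \in msupp f -> mdeg a = m -> hpart f m (fun=> 1) != 0.
Proof.
move=> fs fm af am; apply/eqP => h0; move: af; rewrite mcoeff_msupp.
rewrite (@hpart_eq0 _ _ _ m) ?eqxx // => w w0 w1.
apply/eqP; rewrite -cabs_eq0 eq_le cabs_ge0 andbT -(cabs0 R) -h0.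
exact: hpart_mono.
Qed.

(** * Growth *)

Lemma hpart_le (R : realType) n (f : {mpoly R[i][n]}) (k : nat) (v : 'I_n -> R) (L : R) :
  (forall j, 0 <= v j) -> (forall j, v j <= L) ->
  cabs (hpart f k v) <= L ^+ k * \sum_(a <- msupp f | mdeg a == k) cabs f@_a.
Proof.
move=> v0 vL; apply: (le_trans (@cabs_sum R _ _ _ _)); rewrite mulr_sumr.
apply: ler_sum => a /eqP <-; rewrite cabsM mulrC ler_wpM2r ?cabs_ge0 //.
rewrite cabs_prod mdegE -prodrXr; apply: ler_prod => j _.
by rewrite cabs_ge0 cabsX cabs_real ger0_norm // lerXn2r // nnegrE // (le_trans (v0 j)).
Qed.

Lemma ray1_eval (R : realType) n (f : {mpoly R[i][n]}) (a b : R) :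
  (ray f (fun=> 1)).[(a +i* b)%C] = f.@[cpt (fun=> a) (fun=> b)].
Proof. by rewrite ray_eval; congr (meval _ f); apply: funext => j; rewrite /cpt !mul1r. Qed.

(** Szasz's inequality for the ray with [t^m] removed: [A] bounds [c_0], [c_1], [c_2] and [d] bounds
    [|c_0|] from below, so the coefficient ratios are at most [A / d]. *)
Lemma ray_growth (R : realType) n (f : {mpoly R[i][n]}) (m : nat) (v : 'I_n -> R)
    (t : R[i]) (A d : R) :
  stable f -> (forall a, a \in msupp f -> (m <= mdeg a)%N) -> (forall j, 0 < v j) ->
  0 < d -> d <= cabs (hpart f m v) ->
  (forall k, (k <= 2)%N -> cabs (hpart f (m + k) v) <= A) ->
  cabs (ray f v).[t] <=
    A * cabs t ^+ m * expR (2^-1 + cabs t ^+ 2 * (2 * (A / d) ^+ 2 + A / d)).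
Proof.
move=> fs fm v0 d0 dh hA; pose q := drop_poly m (ray f v).
have qE k : q`_k = hpart f (m + k) v by rewrite coef_drop_poly addnC coef_ray.
have rE := ray_factor v fm; rewrite -/q in rE.
have qs : stable1 q.
  move=> u u0; have := stable_ray fs v0 u0; rewrite rE hornerM.
  by apply: contraNneq => ->; rewrite mul0r.
have dq : d <= cabs q`_0 by rewrite qE addn0.
have q0 : q`_0 != 0 by rewrite -cabs_gt0 (lt_le_trans d0).
have qA k : (k <= 2)%N -> cabs q`_k / cabs q`_0 <= A / d.
  move=> k2; apply: ler_pM; rewrite ?cabs_ge0 ?invr_ge0 ?cabs_ge0 //.
    by rewrite qE hA.
  by rewrite lef_pV2 // posrE (lt_le_trans d0).
rewrite rE hornerM hornerXn cabsM cabsX [A * _]mulrC -mulrA mulrC.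
rewrite ler_wpM2l ?exprn_ge0 ?cabs_ge0 //.
apply: le_trans (stable1_growth t qs q0) _.
apply: ler_pM; rewrite ?cabs_ge0 ?expR_ge0 //; first by rewrite qE hA.
rewrite ler_expR lerD2l ler_wpM2l ?sqr_ge0 // lerD ?qA //.
have r1 : 0 <= cabs q`_1 / cabs q`_0 by rewrite mulr_ge0 ?invr_ge0 ?cabs_ge0.
have q1 := qA 1%N isT; have Ad := le_trans r1 q1.
by rewrite ler_wpM2l // lerXn2r.
Qed.

Lemma cabs_sqr_cpt (R : realType) (a b : R) : cabs (a +i* b)%C ^+ 2 = a ^+ 2 + b ^+ 2.
Proof. by rewrite cabs_sqr. Qed.

(** Apply [stable1_mul_diag] after removing [t^m]; both parameters have squared modulus [2 r^2]. *)
Lemma ray_lower (R : realType) n (f : {mpoly R[i][n]}) (m : nat) (v : 'I_n -> R) (r : R) :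
  stable f -> (forall a, a \in msupp f -> (m <= mdeg a)%N) -> (forall j, 0 < v j) -> 0 <= r ->
  cabs (hpart f m v) ^+ 2 * (2 * r ^+ 2) ^+ m <=
  cabs (ray f v).[(- r +i* r)%C] * cabs (ray f v).[(r +i* r)%C].
Proof.
move=> fs fm v0 r0; pose q := drop_poly m (ray f v).
have rE := ray_factor v fm; rewrite -/q in rE.
have qs : stable1 q.
  move=> u u0; have := stable_ray fs v0 u0; rewrite rE hornerM.
  by apply: contraNneq => ->; rewrite mul0r.
have -> : hpart f m v = q.[0] by rewrite horner_coef0 coef_drop_poly add0n coef_ray.
have rq t : cabs (ray f v).[t] = cabs q.[t] * cabs t ^+ m.
  by rewrite rE hornerM hornerXn cabsM cabsX.
have T : cabs (- r +i* r)%C * cabs (r +i* r)%C = 2 * r ^+ 2.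
  have -> : cabs (- r +i* r)%C = cabs (r +i* r)%C by rewrite /cabs /= sqrrN.
  by rewrite -expr2 cabs_sqr_cpt; ring.
rewrite !rq mulrACA -exprMn T; apply: ler_wpM2r.
  by rewrite exprn_ge0 // mulr_ge0 // sqr_ge0.
by have := stable1_mul_diag qs r0; rewrite cabsM.
Qed.

(* With [p = - r + 3 i r] and [w = Re z + r >= 0], the points [p + w], [p - w] and
   [p + i w] are, up to raising imaginary parts, [z], a point of the ray through [v],
   and a point of the diagonal. *)
Lemma stable_le_rays (R : realType) n (f : {mpoly R[i][n]}) (r : R) (z : 'I_n -> R[i]) :
  stable f -> 0 < r -> (forall j, cabs (z j) <= r) ->
  cabs f.@[z] * cabs (ray f (fun j => (2 * r + cRe (z j)) / r)).[(- r +i* r)%C] <=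
  cabs (ray f (fun=> 1)).[(- r +i* (5 * r))%C] ^+ 2.
Proof.
move=> fs r0 zr; pose x j := cRe (z j).
have r3 : 0 < 3 * r by rewrite mulr_gt0.
have r5 : 0 < 5 * r by rewrite mulr_gt0.
have xr j : - r <= x j /\ x j <= r.
  by apply/andP; rewrite -ler_norml; exact: le_trans (Re_le_cabs (z j)) (zr j).
have wr j : 0 <= x j + r by have [] := xr j; lra.
have b3 j : `|2 * r + x j| <= 3 * r.
  by rewrite ler_norml; have [h1 h2] := xr j; apply/andP; split; lra.
have b5 j : `|3 * r + (x j + r)| <= 5 * r.
  by rewrite ler_norml; have [h1 h2] := xr j; apply/andP; split; lra.
have H1 : cabs f.@[z] <= cabs f.@[cpt x (fun=> 3 * r)].
  have -> : z = cpt x (fun j => cIm (z j)) by apply: funext => j; rewrite /cpt /x; case: (z j).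
  apply: stable_le_Im => // j.
  have := Im_le_cabs (z j); have := zr j; lra.
have H2 := @stable_mul_real R n f (fun=> - r) (fun=> 3 * r) (fun j => x j + r) fs (fun=> r3) wr.
(* The ray point is [- (2 r + x) + i (2 r + x)]: its real part is that of [p - w], and its imaginary
   part is at most [3 r], which explains the height of [p]. *)
have H3 : cabs (ray f (fun j => (2 * r + x j) / r)).[(- r +i* r)%C] <=
    cabs f.@[cpt ((fun=> - r) \- (fun j => x j + r)) (fun=> 3 * r)].
  have vr j : (2 * r + x j) / r * r = 2 * r + x j by rewrite divfK // gt_eqF.
  rewrite ray_eval.
  have -> : (fun j => (2 * r + x j) / r * - r) = (fun=> - r) \- (fun j => x j + r).
    by apply: funext => j /=; rewrite mulrN vr; ring.
  apply: stable_le_Im => // j.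
  by rewrite vr b3.
(* Since [w <= 2 r], the imaginary part of [p + iw] is at most [5 r]. *)
have H4 : cabs f.@[cpt (fun=> - r) ((fun=> 3 * r) \+ (fun j => x j + r))] <=
    cabs (ray f (fun=> 1)).[(- r +i* (5 * r))%C].
  by rewrite ray1_eval; apply: stable_le_Im.
have E : (fun=> - r) \+ (fun j => x j + r) = x by apply: funext => j /=; ring.
rewrite {}E in H2.
apply: le_trans (ler_pM (cabs_ge0 _) (cabs_ge0 _) H1 H3) _.
by apply: le_trans H2 _; apply: lerXn2r H4; rewrite nnegrE; exact: cabs_ge0.
Qed.

(** [F] is [|f(z)|], [L] and [U] are values on the ray through [v], [G] is the value on the
    diagonal, and [s], [t] are the moduli of the parameters for [G] and [U]. Multiplying
    [F L <= G^2] by [U] lets the lower bound on [L U] eliminate [L]. *)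
Lemma growth_combine (R : realType) (F L U G A d Q r s t : R) (m : nat) :
  0 <= F -> 0 <= L -> 0 <= U -> 0 <= G -> 0 <= A -> 0 <= s -> 0 <= t -> 0 < d -> 0 < r ->
  s ^+ 2 = 26 * r ^+ 2 -> t ^+ 2 = 2 * r ^+ 2 ->
  F * L <= G ^+ 2 -> d ^+ 2 * (2 * r ^+ 2) ^+ m <= L * U ->
  G <= A * s ^+ m * expR (2^-1 + s ^+ 2 * Q) ->
  U <= A * t ^+ m * expR (2^-1 + t ^+ 2 * Q) ->
  F <= A ^+ 3 / d ^+ 2 * 13 ^+ m * expR (3 / 2) * expR ((m%:R + 54 * Q) * r ^+ 2).
Proof.
move=> F0 L0 U0 G0 A0 s0 t0 d0 r0 s2 t2 FL LU GB UB.
have GB2 : G ^+ 2 <= A ^+ 2 * (26 * r ^+ 2) ^+ m * expR (1 + 52 * r ^+ 2 * Q).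
  have -> : A ^+ 2 * (26 * r ^+ 2) ^+ m * expR (1 + 52 * r ^+ 2 * Q) =
      (A * s ^+ m * expR (2^-1 + s ^+ 2 * Q)) ^+ 2.
    have E1 : (s ^+ m) ^+ 2 = (26 * r ^+ 2) ^+ m by rewrite -exprM mulnC exprM s2.
    have E2 : expR (2^-1 + s ^+ 2 * Q) ^+ 2 = expR (1 + 52 * r ^+ 2 * Q).
      by rewrite -expRM_natl s2; congr expR; field.
    by rewrite [RHS]exprMn [in RHS]exprMn E1 E2.
  by apply: lerXn2r; rewrite ?nnegrE // (le_trans G0).
(* [t <= (1 + t^2) / 2 <= 1 + r^2 <= exp(r^2)]; this produces the summand [m] in the final
   exponent. *)
have UB2 : U <= A * expR (r ^+ 2) ^+ m * expR (2^-1 + 2 * r ^+ 2 * Q).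
  apply: le_trans UB _; rewrite t2; apply: ler_wpM2r; first exact: expR_ge0.
  apply: ler_wpM2l => //; apply: lerXn2r; rewrite ?nnegrE ?expR_ge0 //.
  apply: le_trans (expR_ge1Dx _).
  have := sqr_ge0 (1 - t); have := sqr_ge0 r; nra.
have P0 : 0 < d ^+ 2 * (2 * r ^+ 2) ^+ m.
  by apply: mulr_gt0; apply: exprn_gt0 => //; apply: mulr_gt0 => //; apply: exprn_gt0.
rewrite -(ler_pM2r P0).
apply: le_trans (ler_wpM2l F0 LU) _; rewrite mulrA.
apply: le_trans (ler_pM (mulr_ge0 F0 L0) U0 (le_trans FL GB2) UB2) _.
have -> : (26 * r ^+ 2) ^+ m = 13 ^+ m * (2 * r ^+ 2) ^+ m.
  by rewrite -exprMn; congr (_ ^+ m); ring.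
have -> : expR (r ^+ 2) ^+ m = expR (m%:R * r ^+ 2) by rewrite expRM_natl.
(* [54 = 52 + 2] and [3 / 2 = 1 + 1 / 2] collect the exponents of [G^2] and [U]. *)
have -> : expR ((m%:R + 54 * Q) * r ^+ 2) = expR (1 + 52 * r ^+ 2 * Q) *
   expR (m%:R * r ^+ 2) * expR (2^-1 + 2 * r ^+ 2 * Q) / expR (3 / 2).
  by rewrite -expRN -!expRD; congr (expR _); field.
rewrite le_eqVlt; apply/orP; left; apply/eqP.
have : expR (3 / 2 : R) != 0 by rewrite gt_eqF ?expR_gt0.
have : d != 0 by rewrite gt_eqF.
move: (expR _) (expR _) (expR _) (expR _) (13 ^+ m) ((2 * _) ^+ m) => e1 e2 e3 e4 e5 e6 h1 h2.
by field; rewrite h1 h2.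
Qed.

Lemma stable_growth (R : realType) n (f : {mpoly R[i][n]}) (m : nat) (A d : R)
    (r : R) (z : 'I_n -> R[i]) :
  stable f -> (forall a, a \in msupp f -> (m <= mdeg a)%N) ->
  0 < d -> d <= cabs (hpart f m (fun=> 1)) ->
  (forall v k, (forall j, 1 <= v j) -> (forall j, v j <= 3) -> (k <= 2)%N ->
     cabs (hpart f (m + k) v) <= A) ->
  0 < r -> (forall j, cabs (z j) <= r) ->
  cabs f.@[z] <= A ^+ 3 / d ^+ 2 * 13 ^+ m * expR (3 / 2) *
    expR ((m%:R + 54 * (2 * (A / d) ^+ 2 + A / d)) * r ^+ 2).
Proof.
move=> fs fm d0 d1 hA r0 zr.
have FL := stable_le_rays fs r0 zr; set v := fun j => _ in FL.
have xr j : - r <= cRe (z j) /\ cRe (z j) <= r.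
  by apply/andP; rewrite -ler_norml; exact: le_trans (Re_le_cabs (z j)) (zr j).
have v1 j : 1 <= v j by rewrite ler_pdivlMr //; have [] := xr j; lra.
have v3 j : v j <= 3 by rewrite ler_pdivrMr //; have [] := xr j; lra.
have v0 j : 0 < v j by exact: lt_le_trans (v1 j).
(* Since [v >= 1] coordinatewise, the lower bound at [(1,...,1)] passes to [v], uniformly in [z]. *)
have dv : d <= cabs (hpart f m v) by apply: le_trans d1 _; apply: hpart_mono.
have A0 : 0 <= A.
  apply: le_trans (hA (fun=> 1) 0%N _ _ _) => [|j|j|]; first exact: cabs_ge0.
  - exact: lexx.
  - by rewrite ler1n.
  - exact: isT.
have LU : d ^+ 2 * (2 * r ^+ 2) ^+ m <=
    cabs (ray f v).[(- r +i* r)%C] * cabs (ray f v).[(r +i* r)%C].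
  apply: le_trans (ray_lower fs fm v0 (ltW r0)); apply: ler_wpM2r.
    by apply: exprn_ge0; apply: mulr_ge0 => //; exact: sqr_ge0.
  by apply: lerXn2r; rewrite ?nnegrE; [exact: ltW | exact: cabs_ge0 | ].
have GB := @ray_growth R n f m (fun=> 1) (- r +i* (5 * r))%C A d fs fm (fun=> ltr01) d0 d1
  (fun k => hA _ k (fun=> lexx 1) (fun=> _)).
have UB := @ray_growth R n f m v (r +i* r)%C A d fs fm v0 d0 dv (fun k => hA v k v1 v3).
apply: growth_combine FL LU (GB _) UB => //; rewrite ?cabs_ge0 ?cabs_sqr_cpt ?ler1n //; ring.
Qed.

(** The radius 0, where directions cannot be rescaled by [1 / r]: here [z] is the origin and
    [ray_growth] at parameter 0 suffices. *)
Lemma stable_growth0 (R : realType) n (f : {mpoly R[i][n]}) (m : nat) (A d : R)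
    (z : 'I_n -> R[i]) :
  stable f -> (forall a, a \in msupp f -> (m <= mdeg a)%N) ->
  0 < d -> d <= cabs (hpart f m (fun=> 1)) ->
  (forall k, (k <= 2)%N -> cabs (hpart f (m + k) (fun=> 1)) <= A) ->
  (forall j, cabs (z j) <= 0) -> cabs f.@[z] <= A * expR (3 / 2).
Proof.
move=> fs fm d0 d1 hA z0.
have A0 : 0 <= A by apply: le_trans (hA 0%N _); rewrite ?cabs_ge0.
have := @ray_growth R n f m (fun=> 1) (0 +i* 0)%C A d fs fm _ d0 d1 hA.
rewrite ray1_eval (_ : cpt _ _ = z); last first.
  apply: funext => j; have := z0 j.
  by rewrite le_eqVlt ltNge cabs_ge0 orbF cabs_eq0 => /eqP ->.
have -> : cabs (0 +i* 0 : R[i])%C = 0 by exact: cabs0.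
rewrite [0 ^+ 2]expr0n mul0r addr0 => /(_ (fun=> ltr01)) H; apply: le_trans H _.
rewrite -mulrA ler_wpM2l //; case: (m) => [|k]; last by rewrite expr0n mul0r expR_ge0.
by rewrite expr0 mul1r ler_expR; lra.
Qed.

(** * Continuity in the coefficients *)

(** For [P] the finite set M_2, this is continuity at [c] in the coefficients indexed by M_2, in
    epsilon-delta form. *)
Definition coef_continuous (R : realType) n (P : mon n -> Prop) (c : mon n -> R[i])
    (F : (mon n -> R[i]) -> R) : Prop :=
  forall eps : R, 0 < eps -> exists2 delta : R, 0 < delta &
    forall d, (forall g, P g -> cabs (c g - d g) < delta) -> `|F c - F d| < eps.

Lemma coef_continuous_cst (R : realType) n (P : mon n -> Prop) (c : mon n -> R[i]) (x : R) :
  coef_continuous P c (fun=> x).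
Proof. by move=> eps e0; exists 1 => // d _; rewrite subrr normr0. Qed.

Lemma coef_continuous_pair (R : realType) n (P : mon n -> Prop) (c : mon n -> R[i])
    (F G : (mon n -> R[i]) -> R) (eps : R) :
  coef_continuous P c F -> coef_continuous P c G -> 0 < eps ->
  exists2 delta : R, 0 < delta & forall d, (forall g, P g -> cabs (c g - d g) < delta) ->
    `|F c - F d| < eps /\ `|G c - G d| < eps.
Proof.
move=> hF hG e0; have [d1 p1 H1] := hF _ e0; have [d2 p2 H2] := hG _ e0.
exists (Num.min d1 d2); first by rewrite lt_min p1.
move=> d hd; split; [apply: H1 | apply: H2] => g /hd; by rewrite lt_min => /andP[].
Qed.

Lemma coef_continuousD (R : realType) n (P : mon n -> Prop) (c : mon n -> R[i])
    (F G : (mon n -> R[i]) -> R) :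
  coef_continuous P c F -> coef_continuous P c G -> coef_continuous P c (fun d => F d + G d).
Proof.
move=> hF hG eps e0; have e2 : 0 < eps / 2 by rewrite divr_gt0.
have [d d0 H] := coef_continuous_pair hF hG e2; exists d => // e /H[].
rewrite opprD addrACA => h1 h2; apply: le_lt_trans (ler_normD _ _) _; lra.
Qed.

Lemma coef_continuousM (R : realType) n (P : mon n -> Prop) (c : mon n -> R[i])
    (F G : (mon n -> R[i]) -> R) :
  coef_continuous P c F -> coef_continuous P c G -> coef_continuous P c (fun d => F d * G d).
Proof.
(* [N] bounds [|F c| + |G e|] as soon as [|G c - G e| < 1]. *)
move=> hF hG eps e0; set N := `|F c| + `|G c| + 1.
have N0 : 0 < N by rewrite ltr_wpDl ?addr_ge0.
have e2 : 0 < Num.min 1 (eps / N) by rewrite lt_min ltr01 divr_gt0.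
have [d d0 H] := coef_continuous_pair hF hG e2; exists d => // e /H[].
rewrite !lt_min => /andP[_ f2] /andP[g1 g2].
have -> : F c * G c - F e * G e = F c * (G c - G e) + G e * (F c - F e) by ring.
apply: le_lt_trans (ler_normD _ _) _; rewrite !normrM.
have gB : `|G e| <= `|G c| + 1.
  rewrite -[G e](subKr (G c)); apply: le_trans (ler_normB _ _) _; lra.
have -> : eps = (eps / N) * N by rewrite divfK // gt_eqF.
move: f2 g2; set t := eps / N => f2 g2.
have h1 : `|F c| * `|G c - G e| <= `|F c| * t by apply: ler_wpM2l => //; exact: ltW.
have h2 : `|G e| * `|F c - F e| <= (`|G c| + 1) * `|F c - F e| by apply: ler_wpM2r.
have h3 : (`|G c| + 1) * `|F c - F e| < (`|G c| + 1) * t.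
  by rewrite ltr_pM2l // ltr_wpDl.
have -> : t * N = `|F c| * t + (`|G c| + 1) * t by rewrite /N; ring.
by apply: ler_ltD => //; exact: le_lt_trans h2 h3.
Qed.

Lemma coef_continuousX (R : realType) n (P : mon n -> Prop) (c : mon n -> R[i])
    (F : (mon n -> R[i]) -> R) (k : nat) :
  coef_continuous P c F -> coef_continuous P c (fun d => F d ^+ k).
Proof.
move=> hF; elim: k => [|k IH].
  have -> : (fun d => F d ^+ 0) = (fun=> 1) by apply: funext => d; rewrite expr0.
  exact: coef_continuous_cst.
have -> : (fun d => F d ^+ k.+1) = (fun d => F d * F d ^+ k).
  by apply: funext => d; rewrite exprS.
exact: coef_continuousM.
Qed.

Lemma coef_continuousV (R : realType) n (P : mon n -> Prop) (c : mon n -> R[i])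
    (F : (mon n -> R[i]) -> R) :
  coef_continuous P c F -> F c != 0 -> coef_continuous P c (fun d => (F d)^-1).
Proof.
move=> hF Fc0 eps e0; have x0 : 0 < `|F c| by rewrite normr_gt0.
(* The first bound keeps [|F e| > |F c| / 2]; the second then makes the difference of inverses
   smaller than [eps]. *)
have e1 : 0 < Num.min (`|F c| / 2) (eps * `|F c| ^+ 2 / 2).
  by rewrite lt_min !divr_gt0 // mulr_gt0 // exprn_gt0.
have [d d0 H] := hF _ e1; exists d => // e /H; rewrite lt_min => /andP[h1 h2].
have y0 : `|F c| / 2 < `|F e|.
  have := ler_normD (F c - F e) (F e); rewrite subrK; lra.
have Fe0 : F e != 0 by rewrite -normr_gt0; apply: le_lt_trans y0; rewrite divr_ge0 ?normr_ge0 ?ler0n.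
have -> : (F c)^-1 - (F e)^-1 = - ((F c - F e) / (F c * F e)) by field; rewrite Fc0 Fe0.
rewrite normrN normrM normfV normrM ltr_pdivrMr; last by rewrite mulr_gt0 // normr_gt0.
apply: lt_trans h2 _; move: x0 y0; move: `|F c| `|F e| => x y x0 y0.
have : 0 < eps * x by exact: mulr_gt0.
nra.
Qed.

Lemma coef_continuous_cabs_sum (R : realType) n (P : mon n -> Prop) (c : mon n -> R[i])
    (s : seq (mon n)) :
  (forall g, g \in s -> P g) -> coef_continuous P c (fun d => cabs (\sum_(g <- s) d g)).
Proof.
(* The successor covers the empty list and keeps the final inequality strict. *)
move=> sP eps e0; exists (eps / (size s).+1%:R); first by rewrite divr_gt0 // ltr0n.
move=> d H.
have tri (x y : R[i]) : `|cabs x - cabs y| <= cabs (x - y).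
  have h1 := @cabsD R (x - y) y; have h2 := @cabsD R (y - x) x.
  rewrite subrK in h1; rewrite subrK -(cabsN (y - x)) opprB in h2.
  rewrite ler_norml; apply/andP; split; lra.
apply: le_lt_trans (tri _ _) _; rewrite -sumrB.
apply: le_lt_trans (@cabs_sum R _ _ _ _) _.
apply: le_lt_trans (_ : _ <= \sum_(g <- s) eps / (size s).+1%:R) _.
  by rewrite !big_seq; apply: ler_sum => g /sP/H/ltW.
rewrite big_const_seq count_predT iter_addr addr0 -[_ *+ size s]mulr_natr mulrAC ltr_pdivrMr ?ltr0n //.
by rewrite ltr_pM2l // ltr_nat.
Qed.

Lemma coef_continuous_sum_cabs (R : realType) n (P : mon n -> Prop) (c : mon n -> R[i])
    (s : seq (mon n)) :
  (forall g, g \in s -> P g) -> coef_continuous P c (fun d => \sum_(g <- s) cabs (d g)).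
Proof.
elim: s => [|g s IH] sP.
  have := @coef_continuous_cst R n P c 0; congr coef_continuous.
  by apply: funext => d; rewrite big_nil.
have -> : (fun d : mon n -> R[i] => \sum_(g0 <- g :: s) cabs (d g0)) =
    (fun d => cabs (\sum_(h <- [:: g]) d h) + \sum_(h <- s) cabs (d h)).
  by apply: funext => d; rewrite big_cons big_seq1.
apply: coef_continuousD; last by apply: IH => h hs; apply: sP; rewrite inE hs orbT.
by apply: coef_continuous_cabs_sum => h; rewrite inE => /eqP ->; apply: sP (mem_head _ _).
Qed.

(** * Minimal exponents *)

Lemma absm_mdeg n (a : mon n) : absm a = mdeg a.
Proof. by rewrite mdegE. Qed.

(** Descent on total degree: a support element strictly below [a] has smaller degree. *)
Lemma minimal_below (R : realType) n (f : {mpoly R[i][n]}) (M : {fset mon n}) (a : mon n) :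
  minimal_set_is f M -> a \in msupp f -> exists2 b, b \in M & le_cw b a.
Proof.
move=> hM; have [k] := ubnP (mdeg a); elim: k a => // k IH a ak af.
have [mina|nmin] := pselect (forall b, supp f b -> le_cw b a -> b = a).
  by exists a => [|j //]; apply/hM; split=> //; rewrite /supp -mcoeff_msupp.
have [b [bf ba bna]] : exists b, [/\ supp f b, le_cw b a & b <> a].
  apply: contrapT => H; apply: nmin => b bf ba; apply: contrapT => bna.
  by apply: H; exists b.
have [||e eM eb] := IH b; last by exists e => // j; exact: leq_trans (eb j) (ba j).
- rewrite ltnS in ak; apply: leq_trans ak; rewrite !mdegE ltn_neqAle leq_sum ?andbT //.
  apply/eqP => E; apply: bna; apply/mnmP => j; apply/eqP.
  have [_] := @leqif_sum _ predT _ _ _ (fun i _ => leqif_eq (ba i)).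
  by rewrite E eqxx => /esym/forallP/(_ j).
- by rewrite mcoeff_msupp.
Qed.

(** A minimal exponent below [a] has degree at least [m], so the remainder has degree at most 2. *)
Lemma in_Ml_low (R : realType) n (f : {mpoly R[i][n]}) (M : {fset mon n}) (m : nat) (a : mon n) :
  minimal_set_is f M -> (forall b, b \in M -> (m <= mdeg b)%N) ->
  a \in msupp f -> (mdeg a <= m + 2)%N -> in_Ml M 2 a.
Proof.
move=> hM mM af am; have [b bM ba] := minimal_below hM af.
have E : a = (b + (a - b))%MM.
  by apply/mnmP => j; rewrite mnmDE mnmBE subnKC.
exists b => //; exists (a - b)%MM; split=> //; rewrite absm_mdeg.
move: am; rewrite {1}E mdegD => am; rewrite -(leq_add2l m).
by apply: leq_trans am; rewrite leq_add2r mM.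
Qed.

(** Trades the support of [f] for a list independent of [f], so that the constants become functions
    of the coefficients. *)
Lemma big_msupp_seq (R : realType) n (f : {mpoly R[i][n]}) (V : nmodType) (s : seq (mon n))
    (Q : pred (mon n)) (F : mon n -> V) :
  uniq s -> (forall a, a \in msupp f -> Q a -> a \in s) -> (forall a, f@_a = 0 -> F a = 0) ->
  \sum_(a <- msupp f | Q a) F a = \sum_(a <- s | Q a) F a.
Proof.
move=> us Hs F0; rewrite -[LHS]big_filter.
have R0 : \sum_(a <- s | Q a && (a \notin msupp f)) F a = 0.
  by rewrite big1 // => a /andP[_ /memN_msupp_eq0/F0].
rewrite [RHS](bigID (mem (msupp f))) /= R0 addr0.
rewrite -[RHS]big_filter; apply: perm_big; apply: uniq_perm.
- exact: filter_uniq (msupp_uniq f).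
- exact: filter_uniq us.
move=> a; rewrite !mem_filter; apply/idP/idP => [/andP[Qa af]|/andP[/andP[Qa af] _]].
  by rewrite Qa Hs //= andbT.
by rewrite Qa.
Qed.

Lemma in_Ml_enum n (M : {fset mon n}) (k : nat) : exists2 s : seq (mon n), uniq s &
  forall a, a \in s <-> in_Ml M 2 a /\ (mdeg a <= k)%N.
Proof.
exists [seq a <- [seq bmnm g | g : 'X_{1..n < k.+1}] | `[< in_Ml M 2 a >]].
  by apply: filter_uniq; rewrite map_inj_uniq ?enum_uniq //; exact: val_inj.
move=> a; rewrite mem_filter; split=> [/andP[/asboolP aM /mapP[g _ ag]]|[aM ak]].
  by split=> //; rewrite ag -ltnS; exact: bmdeg.
apply/andP; split; first exact/asboolP.
by apply/mapP; exists (@BMultinom n k.+1 a ak) => //; rewrite mem_enum.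
Qed.

Lemma min_mdeg n (M : {fset mon n}) : M != fset0 -> exists m,
  (exists2 a, a \in M & mdeg a = m) /\ forall a, a \in M -> (m <= mdeg a)%N.
Proof.
move=> /fset0Pn[a aM].
have ex : exists k, has (fun b => mdeg b == k) M by exists (mdeg a); apply/hasP; exists a.
case: (ex_minnP ex) => m /hasP[b bM /eqP bm] mmin.
exists m; split; first by exists b.
by move=> e eM; apply: mmin; apply/hasP; exists e.
Qed.

(** * The constants as explicit functions of the coefficients indexed by M_2 *)

Unset Implicit Arguments.

Theorem theorem5p6 (R : realType) (n : nat) (M : {fset mon n}) :
  M != fset0 ->
  exists B C : (mon n -> R[i]) -> R,
    (* B and C depend only on the coefficients indexed by M_2 *)
    (forall c d : mon n -> R[i], (forall g, in_Ml M 2 g -> c g = d g) ->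
       B c = B d /\ C c = C d) /\
    (* continuity in those coefficients (on the admissible coefficient families) *)
    (forall c, admissible M c -> forall eps : R, 0 < eps ->
       exists2 delta : R, 0 < delta &
         forall d, admissible M d ->
           (forall g, in_Ml M 2 g -> cabs (c g - d g) < delta) ->
           `|B c - B d| < eps /\ `|C c - C d| < eps) /\
    (* the growth bound *)
    (forall f : mpoly.mpoly n R[i], stable f -> minimal_set_is f M ->
       forall r : R, 0 <= r ->
       forall z : 'I_n -> R[i], (forall i, cabs (z i) <= r) ->
         cabs (mpoly.meval z f) <= B (coefs f) * expR (C (coefs f) * r ^+ 2)).
Proof.
move=> /min_mdeg[m [[a0 a0M a0m] mM]].
have [s us sP] := in_Ml_enum M (m + 2).
have sM g : g \in s -> in_Ml M 2 g by move=> /sP[].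
pose s0 := [seq g <- s | mdeg g == m].
have s0M g : g \in s0 -> in_Ml M 2 g by rewrite mem_filter => /andP[_ /sM].
(* [3 ^+ (m + 2)] dominates every monomial of degree at most [m + 2] on [[1, 3]^n]. *)
pose A (c : mon n -> R[i]) : R := 3 ^+ (m + 2) * \sum_(g <- s) cabs (c g).
(* For admissible [c] this is [|c_0(1,...,1)|]. *)
pose D (c : mon n -> R[i]) : R := cabs (\sum_(g <- s0) c g).
(* The first summand serves [r > 0], the second [r = 0]. Division by zero returns 0, so the formula
   is total. *)
pose B c := A c ^+ 3 / D c ^+ 2 * 13 ^+ m * expR (3 / 2) + A c * expR (3 / 2).
pose C c := m%:R + 54 * (2 * (A c / D c) ^+ 2 + A c / D c).
have low (f : {mpoly R[i][n]}) : minimal_set_is f M -> forall a, a \in msupp f -> (m <= mdeg a)%N.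
  move=> hM a /(minimal_below hM)[b bM ba]; apply: leq_trans (mM b bM) _.
  by rewrite !mdegE leq_sum.
have D_hpart f : minimal_set_is f M -> cabs (hpart f m (fun=> 1)) = D (coefs f).
  move=> hM; rewrite /D big_filter; congr cabs; rewrite /hpart.
  rewrite -(@big_msupp_seq R n f _ s (fun a => mdeg a == m) (coefs f)) //.
    apply: eq_bigr => a _; rewrite big1 ?mulr1 // => j _; exact: expr1n.
  move=> a af /eqP am; apply/sP; split; last by rewrite am leq_addr.
  by apply: (in_Ml_low hM mM af); rewrite am leq_addr.
have D_gt0 f : stable f -> minimal_set_is f M -> 0 < D (coefs f).
  move=> fs hM; rewrite -D_hpart // cabs_gt0.
  apply: hpart1_neq0 a0m => //; first exact: low.
  by rewrite mcoeff_msupp; have [] := (hM a0).1 a0M.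
have A_hpart f v k : minimal_set_is f M -> (forall j, 1 <= v j) -> (forall j, v j <= 3) ->
    (k <= 2)%N -> cabs (hpart f (m + k) v) <= A (coefs f).
  move=> hM v1 v3 k2; apply: le_trans (hpart_le f (m + k) (fun j => le_trans ler01 (v1 j)) v3) _.
  apply: ler_pM.
  - by apply: exprn_ge0.
  - by apply: sumr_ge0 => a _; exact: cabs_ge0.
  - by apply: ler_weXn2l; rewrite ?ler1n ?leq_add2l.
  rewrite (@big_msupp_seq R n f _ s _ (fun a => cabs f@_a)) //; first last.
  - by move=> a ->; exact: cabs0.
  - move=> a af /eqP am; apply/sP; split; last by rewrite am leq_add2l.
    by apply: (in_Ml_low hM mM af); rewrite am leq_add2l.
  by rewrite big_mkcond; apply: ler_sum => a _; case: ifP => // _; exact: cabs_ge0.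
have A_ge0 c : 0 <= A c.
  by apply: mulr_ge0; [exact: exprn_ge0 | apply: sumr_ge0 => g _; exact: cabs_ge0].
exists B, C; split; [|split].
- move=> c d cd.
  have EA : A c = A d.
    by congr (_ * _); rewrite !big_seq; apply: eq_bigr => g /sM/cd ->.
  have ED : D c = D d.
    by congr cabs; rewrite !big_seq; apply: eq_bigr => g /s0M/cd ->.
  by rewrite /B /C EA ED.
- move=> c [f [fs hM cE]] eps e0.
  (* Admissibility of [c] permits inverting [D] at [c]. *)
  have D0 : D c != 0 by rewrite cE gt_eqF // D_gt0.
  have cA : coef_continuous (in_Ml M 2) c A.
    by apply: coef_continuousM; [exact: coef_continuous_cst | exact: coef_continuous_sum_cabs].
  have cD : coef_continuous (in_Ml M 2) c D by exact: coef_continuous_cabs_sum.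
  have cV : coef_continuous (in_Ml M 2) c (fun d => A d / D d).
    by apply: coef_continuousM => //; exact: coef_continuousV.
  have cB : coef_continuous (in_Ml M 2) c B.
    have k (x : R) := @coef_continuous_cst R n (in_Ml M 2) c x.
    apply: coef_continuousD; last exact: coef_continuousM.
    do 2!apply: coef_continuousM => //.
    apply: coef_continuousM; first exact: coef_continuousX.
    by apply: coef_continuousV; [exact: coef_continuousX | rewrite expf_neq0].
  have cC : coef_continuous (in_Ml M 2) c C.
    have k (x : R) := @coef_continuous_cst R n (in_Ml M 2) c x.
    apply: coef_continuousD => //; apply: coef_continuousM => //.
    apply: coef_continuousD => //; apply: coef_continuousM => //; exact: coef_continuousX.
  have [d d0 H] := coef_continuous_pair cB cC e0.
  by exists d => // e _; exact: H.
move=> f fs hM r r0 z zr.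
have d0 := D_gt0 f fs hM; have d1 := D_hpart f hM.
have fm := low f hM; have hA v k := A_hpart f v k hM.
have A0 := A_ge0 (coefs f).
have T1 : 0 <= A (coefs f) ^+ 3 / D (coefs f) ^+ 2 * 13 ^+ m * expR (3 / 2).
  apply: mulr_ge0; last exact: expR_ge0.
  apply: mulr_ge0; last exact: exprn_ge0.
  by apply: divr_ge0; apply: exprn_ge0 => //; exact: ltW.
have T2 : 0 <= A (coefs f) * expR (3 / 2) by apply: mulr_ge0 => //; exact: expR_ge0.
move: r0; rewrite le_eqVlt => /orP[/eqP r0|r0].
  rewrite -r0 expr0n mulr0 expR0 mulr1.
  apply: le_trans (_ : _ <= A (coefs f) * expR (3 / 2)) _; last by rewrite lerDr.
  apply: (@stable_growth0 R n f m _ (D (coefs f))) => //; first by rewrite d1.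
    by move=> k k2; apply: hA => // j; rewrite ler1n.
  by move=> j; rewrite r0.
have H := @stable_growth R n f m (A (coefs f)) (D (coefs f)) r z fs fm d0 _ hA r0 zr.
apply: le_trans (H _) _; first by rewrite d1.
by apply: ler_wpM2r; [exact: expR_ge0 | rewrite /B lerDl].
Qed.
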